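(* Let $m,n\ge1$ and let $A=C(\tilde s,\tilde t)+N\in\mathbb{C}^{m\times n}$ have only nonzero entries, where $\tilde s\in\mathbb{C}^m,\tilde t\in\mathbb{C}^n$ are normalized Cauchy points (for $C(\tilde s,\tilde t)$) and $N\in\mathbb{C}^{m\times n}$. Let $s\in\mathbb{C}^m$, $t\in\mathbb{C}^n$ be such that $\begin{bmatrix}s\\t\end{bmatrix}$ is the minimum 2-norm solution of the least squares problem $$\min_{x\in\mathbb{C}^m,\,y\in\mathbb{C}^n}\ \sum_{i=1}^m\sum_{j=1}^n\left|x_i-y_j-\frac1{a_{ij}}\right|^2 .$$ If $$\gamma:=\|D(\tilde s,\tilde t)\odot N\|_M<1,$$ then $$\frac{\left\|\begin{bmatrix}\tilde s\\\tilde t\end{bmatrix}-\begin{bmatrix}s\\t\end{bmatrix}\right\|_2}{\left\|\begin{bmatrix}\tilde s\\\tilde t\end{bmatrix}\right\|_2}\ \le\ \frac{\sqrt{m+n}}{\min\{\sqrt m,\sqrt n\}}\,\frac{\gamma}{1-\gamma}.$$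
   Context: Vectors $s\in\mathbb{C}^m$, $t\in\mathbb{C}^n$ are called Cauchy points if $s_i-t_j\neq 0$ for all $i,j$; they define the Cauchy matrix $C(s,t)=\left[\frac{1}{s_i-t_j}\right]\in\mathbb{C}^{m\times n}$. For a Cauchy matrix $B$, vectors $\tilde s\in\mathbb{C}^m,\tilde t\in\mathbb{C}^n$ are called normalized Cauchy points for $B$ if $B=C(\tilde s,\tilde t)$ and $\left\|\begin{bmatrix}\tilde s\\ \tilde t\end{bmatrix}\right\|_2$ is minimal among all Cauchy points $s\in\mathbb{C}^m,t\in\mathbb{C}^n$ with $B=C(s,t)$. $D(s,t)=[s_i-t_j]\in\mathbb{C}^{m\times n}$; $\odot$ is the Hadamard (elementwise) product; $\|B\|_M=\max_{i,j}|b_{ij}|$. The entries of $A$ are denoted $a_{ij}$. The minimum 2-norm solution is the least squares minimizer of smallest Euclidean norm. *)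

(* Defs.v *)
From mathcomp Require Import all_boot all_order all_algebra.
From mathcomp Require Import complex reals.

Set Implicit Arguments.
Unset Strict Implicit.
Unset Printing Implicit Defensive.

Import Order.TTheory GRing.Theory Num.Theory.

Local Open Scope ring_scope.
Local Open Scope complex_scope.

(* [normc] is the [R]-valued modulus; the generic norm [`|z|] on [R[i]] takes
   its values in [R[i]], so all norms below are built on [normc]. *)
Notation normc := ComplexField.Normc.normc.

Definition norm2 (R : realType) (p : nat) (v : 'cV[R[i]]_p) : R :=
  Num.sqrt (\sum_(k < p) normc (v k 0) ^+ 2).

Definition normM (R : realType) (m n : nat) (B : 'M[R[i]]_(m, n)) : R :=
  \big[Num.max/0]_(i < m) \big[Num.max/0]_(j < n) normc (B i j).

Definition hadamard (K : pzRingType) (m n : nat) (A B : 'M[K]_(m, n)) :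
  'M[K]_(m, n) := map2_mx *%R A B.

Definition cauchy_points (K : fieldType) (m n : nat)
  (s : 'cV[K]_m) (t : 'cV[K]_n) : Prop := forall i j, s i 0 - t j 0 != 0.

(* Meaningful only when [cauchy_points s t] holds, since [0^-1 = 0]. *)
Definition cauchy_mx (K : fieldType) (m n : nat)
  (s : 'cV[K]_m) (t : 'cV[K]_n) : 'M[K]_(m, n) :=
  \matrix_(i < m, j < n) (s i 0 - t j 0)^-1.

Definition diff_mx (K : fieldType) (m n : nat)
  (s : 'cV[K]_m) (t : 'cV[K]_n) : 'M[K]_(m, n) :=
  \matrix_(i < m, j < n) (s i 0 - t j 0).

Definition normalized_cauchy_points (R : realType) (m n : nat)
  (B : 'M[R[i]]_(m, n)) (s : 'cV[R[i]]_m) (t : 'cV[R[i]]_n) : Prop :=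
  [/\ cauchy_points s t,
      B = cauchy_mx s t &
      forall (s' : 'cV[R[i]]_m) (t' : 'cV[R[i]]_n),
        cauchy_points s' t' -> B = cauchy_mx s' t' ->
        norm2 (col_mx s t) <= norm2 (col_mx s' t')].

Definition ls_objective (R : realType) (m n : nat) (A : 'M[R[i]]_(m, n))
  (x : 'cV[R[i]]_m) (y : 'cV[R[i]]_n) : R :=
  \sum_(i < m) \sum_(j < n) normc (x i 0 - y j 0 - (A i j)^-1) ^+ 2.

Definition ls_solution (R : realType) (m n : nat) (A : 'M[R[i]]_(m, n))
  (x : 'cV[R[i]]_m) (y : 'cV[R[i]]_n) : Prop :=
  forall (x' : 'cV[R[i]]_m) (y' : 'cV[R[i]]_n),
    ls_objective A x y <= ls_objective A x' y'.

Definition min_norm_ls_solution (R : realType) (m n : nat)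
  (A : 'M[R[i]]_(m, n)) (s : 'cV[R[i]]_m) (t : 'cV[R[i]]_n) : Prop :=
  ls_solution A s t /\
  forall (x : 'cV[R[i]]_m) (y : 'cV[R[i]]_n),
    ls_solution A x y -> norm2 (col_mx s t) <= norm2 (col_mx x y).

(* Main.v *)
Require Import Defs.
From mathcomp Require Import all_boot all_order all_algebra.
From mathcomp Require Import complex reals.
From mathcomp Require Import ring lra.

Set Implicit Arguments.
Unset Strict Implicit.
Unset Printing Implicit Defensive.

Import Order.TTheory GRing.Theory Num.Theory.

Local Open Scope ring_scope.
Local Open Scope complex_scope.

(** Let [L (x, y)] be the array of all differences [x_i - y_j], with the
Frobenius norm on arrays. The matrix [D] of differences of the exact Cauchy
points is [L (s0, t0)], and [(s, t)] is the least squares preimage under [L] of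
the array [W] of reciprocals [1 / a_ij]. The bound is a perturbation estimate
for this linear least squares problem.

Each [d = d_ij] and [1 / a_ij] differ by [d * w / (1 + w)], where [w = d * n_ij]
has modulus at most [gamma], so [D - W] is entrywise at most
[gamma / (1 - gamma)] times [D] ([normc_sub_inv_le]). Since [L (s, t)] is the
orthogonal projection of [W] on the range of [L], which contains [D], the array
[L (s0 - s, t0 - t)] has norm at most that of [D - W]
([ls_solution_pythagoras]). It remains to compare norms before and after [L]:
- [|L v| <= sqrt (m + n) |v|] for every [v] ([diff_energy_le]), used for
  [D = L (s0, t0)];
- [|L v| >= sqrt (min m n) |v|] for [v] orthogonal to the all-ones vector, which
  spans the kernel of [L] ([diff_energy_ge]), used for [v = (s0 - s, t0 - t)].
The orthogonality needed in the second bound is what the two minimal norm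
conditions provide: both the Cauchy matrix and the least squares objective are
invariant under translating all coordinates by the same number, so a
minimizer of the norm has coordinates of sum zero ([vsum_eq0_of_min_shift]).

The Euclidean geometry is real: complex vectors are handled through the real
inner product [rdot], in which minimality along real lines gives orthogonality.
*)

(** * The real inner product on the complex plane *)

Section RealInnerProduct.
Variable R : realType.
Implicit Types z w : R[i].

Definition rdot z w : R :=
  complex.Re z * complex.Re w + complex.Im z * complex.Im w.

Lemma normc_ge0 z : 0 <= normc z.
Proof. by case: z => a b; exact: sqrtr_ge0. Qed.

Lemma rdotzz z : rdot z z = normc z ^+ 2.
Proof.
by case: z => a b; rewrite /rdot /normc /= sqr_sqrtr ?addr_ge0 ?sqr_ge0.
Qed.

Lemma rdotC z w : rdot z w = rdot w z.
Proof. by rewrite /rdot; ring. Qed.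

Lemma rdotDl z1 z2 w : rdot (z1 + z2) w = rdot z1 w + rdot z2 w.
Proof. by case: z1 z2 => [? ?] [? ?]; rewrite /rdot /=; ring. Qed.

Lemma rdotNl z w : rdot (- z) w = - rdot z w.
Proof. by case: z => [? ?]; rewrite /rdot /=; ring. Qed.

Lemma rdotZl (a : R) z w : rdot (a%:C * z) w = a * rdot z w.
Proof. by case: z => [? ?]; rewrite /rdot /=; ring. Qed.

Lemma rdot0l w : rdot 0 w = 0.
Proof. by rewrite /rdot /= !mul0r addr0. Qed.

Lemma rdot_suml (I : Type) (r : seq I) (F : I -> R[i]) w :
  rdot (\sum_(k <- r) F k) w = \sum_(k <- r) rdot (F k) w.
Proof.
by elim/big_rec2: _ => [|k u v _ <-]; rewrite ?rdot0l ?rdotDl.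
Qed.

Lemma sqr_normcD z w :
  normc (z + w) ^+ 2 = normc z ^+ 2 + 2 * rdot z w + normc w ^+ 2.
Proof.
by rewrite -!rdotzz rdotDl ![rdot _ (z + w)]rdotC !rdotDl (rdotC w z); ring.
Qed.

Lemma sqr_normcB z w :
  normc (z - w) ^+ 2 = normc z ^+ 2 - 2 * rdot z w + normc w ^+ 2.
Proof.
rewrite sqr_normcD -(rdotzz (- w)) rdotNl !(rdotC _ (- w)) !rdotNl.
by rewrite !rdotzz (rdotC w z); ring.
Qed.

Lemma sqr_normcZ (a : R) z : normc (a%:C * z) ^+ 2 = a ^+ 2 * normc z ^+ 2.
Proof. by rewrite -!rdotzz rdotZl rdotC rdotZl; ring. Qed.

(** First-order optimality: the step [- b / (c + 1)] would strictly decrease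
the quadratic if its slope at the origin did not vanish; adding [1] to the
curvature treats [c = 0] together with [c > 0]. *)
Lemma slope_at_min_eq0 (b c : R) : 0 <= c ->
  (forall a : R, 0 <= 2 * (a * b) + a ^+ 2 * c) -> b = 0.
Proof.
move=> c_ge0 /(_ (- b / (c + 1))).
have c1_gt0 : 0 < c + 1 by lra.
have -> : 2 * (- b / (c + 1) * b) + (- b / (c + 1)) ^+ 2 * c
    = - (b ^+ 2 * ((c + 2) / (c + 1) ^+ 2)) by field; lra.
rewrite oppr_ge0 pmulr_lle0; last by rewrite divr_gt0 ?exprn_gt0 //; lra.
by move=> b2_le0; apply/eqP; rewrite -sqrf_eq0 eq_le b2_le0 sqr_ge0.
Qed.

End RealInnerProduct.

(** * The Euclidean norm and the difference operator *)

Section DifferenceOperator.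
Variable R : realType.

Definition sqnorm (p : nat) (v : 'cV[R[i]]_p) : R :=
  \sum_(k < p) normc (v k 0) ^+ 2.

(** Squared Frobenius norm of the image of [(x, y)] under the difference
operator [(x, y) |-> (x_i - y_j)]. *)
Definition diff_energy (m n : nat) (x : 'cV[R[i]]_m) (y : 'cV[R[i]]_n) : R :=
  \sum_(i < m) \sum_(j < n) normc (x i 0 - y j 0) ^+ 2.

Definition vsum (p : nat) (v : 'cV[R[i]]_p) : R[i] := \sum_(k < p) v k 0.

Lemma sqnorm_ge0 p (v : 'cV[R[i]]_p) : 0 <= sqnorm v.
Proof. by apply: sumr_ge0 => k _; exact: sqr_ge0. Qed.

Lemma diff_energy_ge0 m n (x : 'cV[R[i]]_m) (y : 'cV[R[i]]_n) :
  0 <= diff_energy x y.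
Proof. by apply: sumr_ge0 => i _; apply: sumr_ge0 => j _; exact: sqr_ge0. Qed.

Lemma sqnorm_col_mx m n (x : 'cV[R[i]]_m) (y : 'cV[R[i]]_n) :
  sqnorm (col_mx x y) = sqnorm x + sqnorm y.
Proof.
rewrite /sqnorm big_split_ord /=; congr (_ + _).
  by apply: eq_bigr => i _; rewrite col_mxEu.
by apply: eq_bigr => j _; rewrite col_mxEd.
Qed.

Lemma vsum_col_mx m n (x : 'cV[R[i]]_m) (y : 'cV[R[i]]_n) :
  vsum (col_mx x y) = vsum x + vsum y.
Proof.
rewrite /vsum big_split_ord /=; congr (_ + _).
  by apply: eq_bigr => i _; rewrite col_mxEu.
by apply: eq_bigr => j _; rewrite col_mxEd.
Qed.

Lemma vsumB p (v w : 'cV[R[i]]_p) : vsum (v - w) = vsum v - vsum w.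
Proof. by rewrite /vsum -sumrB; apply: eq_bigr => k _; rewrite !mxE. Qed.

Lemma natr_mul_sum p (a : R) : p%:R * a = \sum_(k < p) a.
Proof. by rewrite sumr_const card_ord mulr_natl. Qed.

Lemma sqnorm_shift p (v : 'cV[R[i]]_p) (h : R[i]) :
  sqnorm (v + const_mx h)
    = sqnorm v + 2 * rdot h (vsum v) + p%:R * normc h ^+ 2.
Proof.
rewrite /sqnorm [rdot h _]rdotC rdot_suml mulr_sumr natr_mul_sum -!big_split /=.
by apply: eq_bigr => k _; rewrite !mxE sqr_normcD.
Qed.

(** The Gram matrix of [(x, y) |-> (x_i - y_j)] has the scalar matrices [n] and
[m] as diagonal blocks and the constant [-1] in the other two blocks, so the
cross term only sees the two sums. *)
Lemma diff_energyE m n (x : 'cV[R[i]]_m) (y : 'cV[R[i]]_n) :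
  diff_energy x y
    = n%:R * sqnorm x + m%:R * sqnorm y - 2 * rdot (vsum x) (vsum y).
Proof.
have inner i : \sum_(j < n) normc (x i 0 - y j 0) ^+ 2
    = n%:R * normc (x i 0) ^+ 2 - 2 * rdot (x i 0) (vsum y) + sqnorm y.
  rewrite [rdot _ _]rdotC rdot_suml (natr_mul_sum n) mulr_sumr -sumrB.
  rewrite /sqnorm -big_split /=.
  by apply: eq_bigr => j _; rewrite sqr_normcB (rdotC (y j 0)).
rewrite /diff_energy (eq_bigr _ (fun i _ => inner i)) big_split /= sumrB.
rewrite -!mulr_sumr sumr_const card_ord -rdot_suml.
by rewrite -(mulr_natl (sqnorm y)) /vsum /sqnorm; ring.
Qed.

(** Cauchy-Schwarz against the all-ones vector, read off from the nonnegative
sum of all pairwise [|v_k - v_l|^2]. *)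
Lemma sqr_normc_vsum_le p (v : 'cV[R[i]]_p) :
  normc (vsum v) ^+ 2 <= p%:R * sqnorm v.
Proof. by have := diff_energy_ge0 v v; rewrite diff_energyE rdotzz; lra. Qed.

(** The largest singular value of the difference operator is at most
[sqrt (m + n)]: the defect in the inequality dominates
[|sum of x + sum of y|^2]. *)
Lemma diff_energy_le m n (x : 'cV[R[i]]_m) (y : 'cV[R[i]]_n) :
  diff_energy x y <= (m + n)%:R * sqnorm (col_mx x y).
Proof.
have := sqr_ge0 (normc (vsum x + vsum y)); rewrite sqr_normcD.
have := sqr_normc_vsum_le x; have := sqr_normc_vsum_le y.
by rewrite diff_energyE sqnorm_col_mx natrD; lra.
Qed.

(** The kernel of the difference operator is spanned by the all-ones vector. On
its orthogonal complement the cross term becomes [2 |sum of x|^2], so the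
singular values there are at least [sqrt (min m n)]. *)
Lemma diff_energy_ge m n (x : 'cV[R[i]]_m) (y : 'cV[R[i]]_n) (c : R) :
  c <= m%:R -> c <= n%:R -> vsum (col_mx x y) = 0 ->
  c * sqnorm (col_mx x y) <= diff_energy x y.
Proof.
move=> c_le_m c_le_n /eqP; rewrite vsum_col_mx addrC addr_eq0 => /eqP yE.
rewrite diff_energyE sqnorm_col_mx yE rdotC rdotNl rdotzz.
have := sqr_ge0 (normc (vsum x)).
have := ler_wpM2r (sqnorm_ge0 x) c_le_n.
by have := ler_wpM2r (sqnorm_ge0 y) c_le_m; lra.
Qed.

(** Minimality of the norm along the line through [v] in direction
[vsum v * (1, ..., 1)] already makes [v] orthogonal to the all-ones vector. *)
Lemma vsum_eq0_of_min_shift p (v : 'cV[R[i]]_p) :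
  (forall h, sqnorm v <= sqnorm (v + const_mx h)) -> vsum v = 0.
Proof.
move=> v_min; apply: ComplexField.Normc.eq0_normc; apply/eqP.
rewrite -sqrf_eq0; apply/eqP.
apply: (@slope_at_min_eq0 _ _ (p%:R * normc (vsum v) ^+ 2)) => [|a].
  by rewrite mulr_ge0 ?sqr_ge0.
have := v_min (a%:C * vsum v).
by rewrite sqnorm_shift rdotZl rdotzz sqr_normcZ; lra.
Qed.

Lemma norm2_le_sqnorm p (v w : 'cV[R[i]]_p) :
  (norm2 v <= norm2 w) = (sqnorm v <= sqnorm w).
Proof. by rewrite /norm2 ler_sqrt ?sqnorm_ge0. Qed.

Lemma col_mx_shift m n (x : 'cV[R[i]]_m) (y : 'cV[R[i]]_n) h :
  col_mx x y + const_mx h = col_mx (x + const_mx h) (y + const_mx h).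
Proof. by rewrite -(@col_mx_const _ m n 1) add_col_mx. Qed.

Lemma shift_diff m n (x : 'cV[R[i]]_m) (y : 'cV[R[i]]_n) h i j :
  (x + const_mx h) i 0 - (y + const_mx h) j 0 = x i 0 - y j 0.
Proof. by rewrite !mxE; ring. Qed.

(** Translating all the Cauchy points does not change the Cauchy matrix. *)
Lemma normalized_cauchy_points_vsum0 m n (B : 'M[R[i]]_(m, n))
    (s : 'cV[R[i]]_m) (t : 'cV[R[i]]_n) :
  normalized_cauchy_points B s t -> vsum (col_mx s t) = 0.
Proof.
case=> st_cauchy BE st_min; apply: vsum_eq0_of_min_shift => h.
rewrite -norm2_le_sqnorm col_mx_shift; apply: st_min => [i j|].
  by rewrite shift_diff; exact: st_cauchy.
by rewrite BE; apply/matrixP => i j; rewrite [LHS]mxE [RHS]mxE shift_diff.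
Qed.

(** Translating all the unknowns does not change the residual. *)
Lemma min_norm_ls_solution_vsum0 m n (A : 'M[R[i]]_(m, n))
    (s : 'cV[R[i]]_m) (t : 'cV[R[i]]_n) :
  min_norm_ls_solution A s t -> vsum (col_mx s t) = 0.
Proof.
case=> st_ls st_min; apply: vsum_eq0_of_min_shift => h.
rewrite -norm2_le_sqnorm col_mx_shift; apply: st_min => x y.
suff -> : ls_objective A (s + const_mx h) (t + const_mx h) = ls_objective A s t.
  exact: st_ls.
by apply: eq_bigr => i _; apply: eq_bigr => j _; rewrite shift_diff.
Qed.

(** Pythagoras: the residual at the least squares solution is orthogonal to the
range of the difference operator, so moving to any other point adds the energy
of the displacement to the objective. *)
Lemma ls_solution_pythagoras m n (A : 'M[R[i]]_(m, n))
    (s x : 'cV[R[i]]_m) (t y : 'cV[R[i]]_n) :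
  ls_solution A s t ->
  ls_objective A x y = ls_objective A s t + diff_energy (x - s) (y - t).
Proof.
move=> st_ls.
pose u i j := (x - s) i 0 - (y - t) j 0.
pose b := \sum_(i < m) \sum_(j < n) rdot (u i j) (s i 0 - t j 0 - (A i j)^-1).
(* Along the line from [(s, t)] to [(x, y)] the objective is a quadratic in the
   real parameter [a]: [2 * b] is its slope at [(s, t)], [a = 1] is [(x, y)]. *)
have objE (a : R) :
    ls_objective A (s + a%:C *: (x - s)) (t + a%:C *: (y - t))
    = ls_objective A s t + 2 * (a * b) + a ^+ 2 * diff_energy (x - s) (y - t).
  rewrite /ls_objective /b /diff_energy !mulr_sumr -!big_split /=.
  apply: eq_bigr => i _; rewrite !mulr_sumr -!big_split /=.
  apply: eq_bigr => j _; rewrite -/(u i j) -sqr_normcZ -rdotZl rdotC.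
  by rewrite -sqr_normcD /u !mxE; congr (normc _ ^+ 2); ring.
have b0 : b = 0.
  apply: (slope_at_min_eq0 (diff_energy_ge0 (x - s) (y - t))) => a.
  have := st_ls (s + a%:C *: (x - s)) (t + a%:C *: (y - t)).
  by rewrite objE; lra.
by have := objE 1; rewrite !scale1r b0 ![_ + (_ - _)]addrC !subrK => ->; ring.
Qed.

End DifferenceOperator.

(** * Perturbation of the reciprocal entries *)

Section Perturbation.
Variable R : realType.

Lemma normc_le_normM m n (B : 'M[R[i]]_(m, n)) i j : normc (B i j) <= normM B.
Proof.
apply: (@le_trans _ _ (\big[Num.max/0]_(k < n) normc (B i k))).
  exact: (le_bigmax_cond _ (fun k => normc (B i k))).
exact: (le_bigmax_cond _ (fun l => \big[Num.max/0]_(k < n) normc (B l k))).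
Qed.

Lemma normM_ge0 m n (B : 'M[R[i]]_(m, n)) : 0 <= normM B.
Proof. exact: bigmax_ge_id. Qed.

(** With [a = d^-1 + e] one has [a = (1 + d * e) / d], hence
[(d - a^-1) * (1 + d * e) = d * (d * e)], and [1 + d * e] has modulus at least
[1 - g]. *)
Lemma normc_sub_inv_le (d e : R[i]) (g : R) :
  d != 0 -> d^-1 + e != 0 -> normc (d * e) <= g -> g < 1 ->
  normc (d - (d^-1 + e)^-1) <= g / (1 - g) * normc d.
Proof.
move=> d_neq0 a_neq0 de_le g_lt1; set E := d - _.
have g1_gt0 : 0 < 1 - g by lra.
have EE : E * (1 + d * e) = d * (d * e).
  have aE : 1 + d * e = d * (d^-1 + e) by rewrite mulrDr mulfV.
  by rewrite /E mulrBl aE mulrCA (mulrCA _ d) mulVf // -aE; ring.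
have den_ge : 1 - g <= normc (1 + d * e).
  have := le_normcD (1 + d * e) (- (d * e)).
  rewrite addrK normcN ComplexField.Normc.normc1; lra.
rewrite mulrAC ler_pdivlMr //.
apply: le_trans (ler_wpM2l (normc_ge0 E) den_ge) _.
rewrite -ComplexField.Normc.normcM EE ComplexField.Normc.normcM [leLHS]mulrC.
by have := ler_wpM2r (normc_ge0 d) de_le.
Qed.

End Perturbation.

Unset Implicit Arguments.

(** * The error bound *)

Theorem theorem3p6 (R : realType) (m n : nat) (m_ge1 : (1 <= m)%N)
    (n_ge1 : (1 <= n)%N) (A N : 'M[R[i]]_(m, n))
    (s0 s : 'cV[R[i]]_m) (t0 t : 'cV[R[i]]_n)
    (A_eq : A = cauchy_mx s0 t0 + N)
    (A_neq0 : forall i j, A i j != 0)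
    (s0t0_normalized : normalized_cauchy_points (cauchy_mx s0 t0) s0 t0)
    (st_ls : min_norm_ls_solution A s t) :
  let gamma := normM (hadamard (diff_mx s0 t0) N) in
  gamma < 1 ->
  norm2 (col_mx s0 t0 - col_mx s t) / norm2 (col_mx s0 t0) <=
    Num.sqrt (m + n)%:R / Num.min (Num.sqrt m%:R) (Num.sqrt n%:R)
      * (gamma / (1 - gamma)).
Proof.
move=> gamma gamma_lt1.
have [st0_cauchy _ _] := s0t0_normalized.
set q := gamma / (1 - gamma).
have q_ge0 : 0 <= q by rewrite divr_ge0 ?normM_ge0 // subr_ge0 ltW.
set c : R := Num.min m%:R n%:R.
have c_gt0 : 0 < c by rewrite lt_min !ltr0n m_ge1.
have minE : Num.min (Num.sqrt m%:R) (Num.sqrt n%:R) = Num.sqrt c.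
  rewrite /c; case: (leP (m%:R : R) n%:R) => mn.
    by rewrite min_l // ler_sqrt.
  by rewrite min_r // ler_sqrt // ltW.
(* At the exact points the residual is [D - W], bounded entry by entry. *)
have obj_le : ls_objective A s0 t0 <= q ^+ 2 * diff_energy s0 t0.
  rewrite /diff_energy mulr_sumr; apply: ler_sum => i _.
  rewrite mulr_sumr; apply: ler_sum => j _; rewrite -exprMn.
  rewrite lerXn2r ?nnegrE ?normc_ge0 ?(mulr_ge0 q_ge0 (normc_ge0 _)) //.
  have := A_neq0 i j; rewrite A_eq !mxE => a_neq0.
  apply: normc_sub_inv_le => //.
  by have := normc_le_normM (hadamard (diff_mx s0 t0) N) i j; rewrite !mxE.
have sqnorm_le : c * sqnorm (col_mx s0 t0 - col_mx s t)
    <= q ^+ 2 * ((m + n)%:R * sqnorm (col_mx s0 t0)).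
  apply: le_trans (ler_wpM2l (sqr_ge0 q) (diff_energy_le s0 t0)).
  apply: le_trans obj_le.
  have [st_sol _] := st_ls.
  rewrite (ls_solution_pythagoras s0 t0 st_sol).
  have sum0 : vsum (col_mx s0 t0 - col_mx s t) = 0.
    rewrite vsumB (normalized_cauchy_points_vsum0 s0t0_normalized).
    by rewrite (min_norm_ls_solution_vsum0 st_ls) subrr.
  rewrite opp_col_mx add_col_mx in sum0 *.
  have c_le_m : c <= m%:R by rewrite ge_min lexx.
  have c_le_n : c <= n%:R by rewrite ge_min lexx orbT.
  apply: le_trans (diff_energy_ge c_le_m c_le_n sum0) _.
  rewrite lerDr; apply: sumr_ge0 => i _.
  by apply: sumr_ge0 => j _; exact: sqr_ge0.
rewrite minE mulrAC.
(* If the Cauchy points all vanish, the quotient is [0] by the convention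
   [0^-1 = 0]. *)
have [->|norm_neq0] := eqVneq (norm2 (col_mx s0 t0)) 0.
  rewrite invr0 mulr0; apply: divr_ge0; last exact: sqrtr_ge0.
  by apply: mulr_ge0 => //; exact: sqrtr_ge0.
rewrite ler_pdivrMr; last by rewrite lt_def norm_neq0 sqrtr_ge0.
rewrite [leRHS]mulrAC ler_pdivlMr ?sqrtr_gt0 //.
(* Writing [q] as [sqrt (q ^+ 2)] puts everything under square roots. *)
rewrite mulrC [Num.sqrt _ * q]mulrC -[q in leRHS](ger0_norm q_ge0) -sqrtr_sqr.
have qmn_ge0 : 0 <= q ^+ 2 * (m + n)%:R.
  by apply: mulr_ge0; [exact: sqr_ge0 | exact: ler0n].
rewrite /norm2 -!sqrtrM ?sqr_ge0 ?qmn_ge0 ?(ltW c_gt0) //.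
rewrite ler_sqrt ?(mulr_ge0 qmn_ge0 (sqnorm_ge0 _)) // -mulrA.
exact: sqnorm_le.
Qed.
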